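(* Let $W$ be an algebraic variety over $\mathbb{C}$, smooth in codimension 1, with $K_W$ Cartier. If, up to isomorphisms, $W$ admits a unique crepant resolution $\pi: X\to W$, then any automorphism of $W$ lifts to $X$; that is, for every automorphism $\psi$ of $W$ there is an automorphism $\widetilde{\psi}$ of $X$ with $\pi\circ\widetilde{\psi}=\psi\circ\pi$.
   Context: A resolution of singularities $\pi: X\to W$ is crepant if $\pi^*K_W=K_X$; by convention crepant resolutions are projective morphisms. Two crepant resolutions $\pi: X\to W$, $\pi^+: X^+\to W$ are isomorphic if the natural birational map $\pi^{-1}\circ\pi^+: X^+\dashrightarrow X$ is an isomorphism. *)

(* Defs.v *)
(** Algebraic varieties over an algebraically closed field [K], in the classical
    language (Serre, Mumford): topological spaces with a sheaf of [K]-valued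
    functions, locally isomorphic to Zariski-closed subsets of affine spaces. *)
From HB Require Import structures.
From mathcomp Require Import all_boot all_order all_algebra.
From mathcomp Require Import classical_sets reals topology_structure.
From mathcomp Require Import complex.
From mathcomp Require Import mpoly.

Set Implicit Arguments.
Unset Strict Implicit.
Unset Printing Implicit Defensive.

Import GRing.Theory.
Local Open Scope classical_set_scope.
Local Open Scope ring_scope.

(** The sheaf is given by its germs: the sections over an open set [U] are the
    functions regular at every point of [U], and the values outside [U] are
    irrelevant. The locality of [regular_at] is not required here, since it holds
    on every space covered by the charts of [affine_open]. *)
Record space (K : closedFieldType) := Space {
  carrier :> topologicalType;
  regular_at : (carrier -> K) -> carrier -> Prop }.

Section Varieties.
Context {K : closedFieldType}.
Implicit Types X Y W : space K.

Definition open_nbhd (T : topologicalType) (U : set T) (x : T) : Prop :=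
  open U /\ U x.

(** For [X] irreducible: [P] holds on a dense open subset. *)
Definition generically (T : topologicalType) (P : T -> Prop) : Prop :=
  exists U : set T, [/\ open U, U !=set0 & forall x, U x -> P x].

Definition morphic_at X Y (f : X -> Y) (x : X) : Prop :=
  continuous_at x f /\
  forall g : Y -> K, regular_at g (f x) -> regular_at (g \o f) x.

Definition morphism X Y (f : X -> Y) : Prop := forall x, morphic_at f x.

Definition isomorphism X Y (f : X -> Y) : Prop :=
  morphism f /\
  exists g : Y -> X, [/\ morphism g, cancel f g & cancel g f].

(** [frac D g] lists the basic open subsets [D] and the fractions [g] over [D]
    coming from an ambient space into which [U] is mapped; the topology and the
    regular functions of the open subspace [U] are those induced by this
    ambient space. *)
Definition induced_structure X (U : set X)
    (frac : set X -> (X -> K) -> Prop) : Prop :=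
  (forall V : set X, V `<=` U ->
     (open V <->
      forall x, V x -> exists D g, [/\ frac D g, D x & D `<=` V])) /\
  (forall x, U x -> forall f : X -> K,
     regular_at f x <->
     exists D g, [/\ frac D g, D x & forall y, D y -> f y = g y]).

(** The coordinates [phi] identify the open subspace [U] with the
    Zariski-closed subset of [K^n] defined by the equations [S]. *)
Definition affine_open X (U : set X) : Prop :=
  open U /\
  exists (n : nat) (phi : X -> 'I_n -> K) (S : set {mpoly K[n]}),
  [/\ forall x y, U x -> U y -> phi x = phi y -> x = y,
      forall c : 'I_n -> K,
        (forall P, S P -> P.@[c] = 0) <-> (exists2 x, U x & phi x = c) &
      induced_structure U (fun D g => exists P Q : {mpoly K[n]},
        D = [set x | U x /\ Q.@[phi x] <> 0] /\
        g = (fun x => P.@[phi x] / Q.@[phi x]))].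

Definition prevariety X : Prop :=
  exists (m : nat) (U : 'I_m -> set X),
    (forall i, affine_open (U i)) /\ (forall x, exists i, U i x).

Definition separated X : Prop :=
  forall Y, prevariety Y -> forall f g : Y -> X, morphism f -> morphism g ->
  closed [set y | f y = g y].

Definition irreducible (T : topologicalType) (Z : set T) : Prop :=
  Z !=set0 /\
  forall A B : set T, open A -> open B ->
    (Z `&` A) !=set0 -> (Z `&` B) !=set0 -> (Z `&` (A `&` B)) !=set0.

Definition irreducible_closed (T : topologicalType) (Z : set T) : Prop :=
  irreducible Z /\ closed Z.

End Varieties.

Record variety (K : closedFieldType) := Variety {
  variety_space :> space K;
  variety_prevariety : prevariety variety_space;
  variety_separated : separated variety_space;
  variety_irreducible : irreducible [set: variety_space] }.

Section Geometry.
Context {K : closedFieldType}.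
Implicit Types X Y W : space K.

Definition chain_of_length (T : topologicalType) (n : nat) : Prop :=
  exists Z : nat -> set T,
    (forall i, (i <= n)%N -> irreducible_closed (Z i)) /\
    (forall i, (i < n)%N -> Z i `<` Z i.+1).

Definition has_dim (T : topologicalType) (n : nat) : Prop :=
  chain_of_length T n /\ ~ chain_of_length T n.+1.

(** Derivations at [p] of the local ring at [p]. The values of [v] on functions
    that are not regular at [p] are irrelevant. *)
Definition tangent X (p : X) (v : (X -> K) -> K) : Prop :=
  forall f g : X -> K, regular_at f p -> regular_at g p ->
    (forall c : K, v (fun x => c * f x + g x) = c * v f + v g) /\
    v (fun x => f x * g x) = f p * v g + g p * v f.

Definition tangent_basis X (p : X) (n : nat)
    (e : 'I_n -> (X -> K) -> K) : Prop :=
  [/\ forall i, tangent p (e i),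
      forall c : 'I_n -> K,
        (forall f, regular_at f p -> \sum_i c i * e i f = 0) ->
        forall i, c i = 0 &
      forall v, tangent p v -> exists c : 'I_n -> K,
        forall f, regular_at f p -> v f = \sum_i c i * e i f].

Definition smooth_at X (p : X) : Prop :=
  exists2 n, has_dim X n & exists e, tangent_basis (n := n) p e.

Definition smooth X : Prop := forall p : X, smooth_at p.

(** Irreducible closed subsets of codimension 1 in an irreducible space. *)
Definition prime_divisor (T : topologicalType) (Z : set T) : Prop :=
  [/\ irreducible_closed Z, Z <> setT &
      forall Z', irreducible_closed Z' -> Z `<=` Z' -> Z' = Z \/ Z' = setT].

Definition smooth_in_codim1 X : Prop :=
  forall Z : set X, prime_divisor Z -> exists2 p, Z p & smooth_at p.

Definition invertible_rational X (f : X -> K) : Prop :=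
  generically (fun x => regular_at f x /\ f x <> 0).

(** The rational functions [f] and [g] have the same divisor near [p]. *)
Definition same_divisor_at X (f g : X -> K) (p : X) : Prop :=
  exists u : X -> K, [/\ regular_at u p, u p <> 0 &
    generically (fun x => f x = u x * g x)].

(** A Cartier divisor is given by a local equation [D p] at every point [p]. *)
Definition cartier X (D : X -> X -> K) : Prop :=
  forall p, invertible_rational (D p) /\
    exists2 U, open_nbhd U p &
      forall q, U q -> same_divisor_at (D p) (D q) q.

Definition pullback X W (pi : X -> W) (D : W -> W -> K) : X -> X -> K :=
  fun p => D (pi p) \o pi.

(** An [n]-form assigns a scalar to [n] tangent vectors at a point; only its
    values on tangent vectors matter. *)
Definition form X (n : nat) := X -> ('I_n -> (X -> K) -> K) -> K.

Definition tangents X (p : X) (n : nat) (v : 'I_n -> (X -> K) -> K) : Prop :=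
  forall i, tangent p (v i).

(** Near [p], [w] is a finite sum of terms [f dg_1 /\ ... /\ dg_n]. *)
Definition regular_form_at X n (w : form X n) (p : X) : Prop :=
  exists2 U, open_nbhd U p &
  exists (m : nat) (f : 'I_m -> X -> K) (g : 'I_m -> 'I_n -> X -> K),
  forall q, U q ->
    [/\ forall i, regular_at (f i) q,
        forall i b, regular_at (g i b) q &
        forall v, tangents q v ->
          w q v = \sum_i f i q * \det (\matrix_(a, b) v a (g i b))].

Definition nonzero_form_at X n (w : form X n) (p : X) : Prop :=
  exists2 v, tangents p v & w p v <> 0.

Definition nonzero_rational_form X n (w : form X n) : Prop :=
  generically (fun p => regular_form_at w p /\ nonzero_form_at w p).

(** [f] is a local equation at the smooth point [p] of the divisor of the
    rational form [w] of top degree: the form [eta] generates the canonical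
    sheaf near [p]. *)
Definition form_equation_at X n (w : form X n) (f : X -> K) (p : X) : Prop :=
  exists eta : form X n,
    [/\ regular_form_at eta p, nonzero_form_at eta p &
        generically (fun q =>
          forall v, tangents q v -> w q v = f q * eta q v)].

(** When [W] is smooth in codimension 1, the Weil divisor [K_W] is the closure
    of the divisor, on the smooth locus, of a nonzero rational form of top
    degree. The Cartier divisor [D] represents [K_W] when it restricts to that
    divisor on the smooth locus. As the form varies, one gets the whole class of
    canonical divisors modulo linear equivalence. *)
Definition canonical_divisor W (D : W -> W -> K) : Prop :=
  cartier D /\
  exists2 n, has_dim W n &
  exists2 w : form W n, nonzero_rational_form w &
    forall p, smooth_at p -> form_equation_at w (D p) p.

Definition canonical_cartier W : Prop := exists D, canonical_divisor (W := W) D.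

(** [s] represents the rational map inverse to [pi]; its values outside a dense
    open subset are irrelevant. *)
Definition rational_inverse X W (pi : X -> W) (s : W -> X) : Prop :=
  exists (U : set X) (V : set W),
  [/\ open U /\ U !=set0, open V /\ V !=set0,
      forall x, U x -> V (pi x) /\ s (pi x) = x &
      forall w, V w -> [/\ U (s w), pi (s w) = w & morphic_at s w]].

Definition birational X W (pi : X -> W) : Prop :=
  exists s, rational_inverse pi s.

(** Forms of degree [d] in [N+1] homogeneous coordinates whose coefficients are
    regular functions on the open subset [O] of [W]. *)
Definition relative_form W N (O : set W) (d : nat)
    (F : W -> {mpoly K[N.+1]}) : Prop :=
  forall w, O w ->
    F w \is d.-homog /\ forall m, regular_at (fun w' => (F w')@_m) w.

(** [pi] factors as a closed immersion [X -> P^N x W] followed by the second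
    projection. The map [X -> P^N] is given by homogeneous coordinates [a]. The
    basic open subsets of [P^N x W] are the sets [G <> 0] over an open [O], for
    a relative form [G] over [O]; the fractions over them are the [F / G] with
    [F] of the same degree. That [a] is a morphism to [P^N] follows from the
    last clause applied to the quotients of coordinates. *)
Definition projective X W (pi : X -> W) : Prop :=
  exists (N : nat) (a : X -> 'I_N.+1 -> K),
  [/\ forall x, exists i, a x i <> 0,
      forall x y (c : K), pi x = pi y -> (forall i, a x i = c * a y i) -> x = y,
      forall (w : W) (b : 'I_N.+1 -> K), (exists i, b i <> 0) ->
        ~ (exists x (c : K), pi x = w /\ forall i, b i = c * a x i) ->
        exists (O : set W) d F,
          [/\ open_nbhd O w, relative_form O d F, (F w).@[b] <> 0 &
              forall x, O (pi x) -> (F (pi x)).@[a x] = 0] &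
      induced_structure setT (fun D g => exists (O : set W) d F G,
        [/\ open O, relative_form O d F, relative_form O d G,
            D = [set x | O (pi x) /\ (G (pi x)).@[a x] <> 0] &
            g = (fun x => (F (pi x)).@[a x] / (G (pi x)).@[a x])])].

Definition resolution X W (pi : X -> W) : Prop :=
  [/\ smooth X, morphism pi, projective pi & birational pi].

(** [pi^* K_W = K_X] as divisor classes. *)
Definition crepant X W (pi : X -> W) : Prop :=
  forall D, canonical_divisor (W := W) D -> canonical_divisor (pullback pi D).

Definition crepant_resolution X W (pi : X -> W) : Prop :=
  resolution pi /\ crepant pi.

(** The rational map [pi^-1 o pi'] is represented by an isomorphism. *)
Definition isomorphic_resolutions X X' W (pi : X -> W) (pi' : X' -> W) : Prop :=
  exists s, rational_inverse pi s /\
  exists phi : X' -> X, isomorphism phi /\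
    generically (fun x => phi x = s (pi' x)).

Definition automorphism X (f : X -> X) : Prop := isomorphism f.

End Geometry.

(* Main.v *)
(** Composing the unique crepant resolution [pi] with [psi] yields another crepant
    resolution, because automorphisms preserve canonical divisors. By uniqueness
    some automorphism [psit] of [X] agrees with [pi^-1 o psi o pi] generically, so
    [pi o psit] and [psi o pi] agree on a dense open subset, hence everywhere since
    [W] is separated. *)
Require Import Defs.
From mathcomp Require Import all_boot all_order all_algebra.
From mathcomp Require Import boolp classical_sets reals topology_structure.
From mathcomp Require Import complex.

Set Implicit Arguments.
Unset Strict Implicit.

Local Open Scope classical_set_scope.
Local Open Scope ring_scope.

Section Transport.
Context {K : closedFieldType}.
Implicit Types X Y Z W : Defs.space K.

(** * Morphisms, and properties that hold on a dense open subset *)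

Lemma morphic_at_comp X Y Z (f : X -> Y) (g : Y -> Z) (x : X) :
  morphic_at f x -> morphic_at g (f x) -> morphic_at (g \o f) x.
Proof.
move=> [cf rf] [cg rg]; split; first exact: continuous_comp.
by move=> h /rg /rf.
Qed.

Lemma morphism_comp X Y Z (f : X -> Y) (g : Y -> Z) :
  morphism f -> morphism g -> morphism (g \o f).
Proof. by move=> mf mg x; apply: morphic_at_comp. Qed.

Lemma morphism_open_preimage X Y (f : X -> Y) (U : set Y) :
  morphism f -> open U -> open (f @^-1` U).
Proof. by move=> mf; apply: open_comp => x _; case: (mf x). Qed.

Lemma morphism_regular X Y (f : X -> Y) (h : Y -> K) (x : X) :
  morphism f -> regular_at h (f x) -> regular_at (h \o f) x.
Proof. by move=> mf; apply: (mf x).2. Qed.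

Lemma generically_and (T : topologicalType) (P Q : T -> Prop) :
  irreducible [set: T] -> generically P -> generically Q ->
  generically (fun x => P x /\ Q x).
Proof.
move=> [_ irrT] [U [oU [u Uu] PU]] [V [oV [v Vv] QV]].
exists (U `&` V); split; first exact: openI.
  have [||x [_ UVx]] := irrT U V oU oV; [by exists u|by exists v|by exists x].
by move=> x [/PU ? /QV ?].
Qed.

Lemma generically_imply (T : topologicalType) (P Q : T -> Prop) :
  (forall x, P x -> Q x) -> generically P -> generically Q.
Proof. by move=> PQ [U [oU U0 PU]]; exists U; split=> // x /PU /PQ. Qed.

(** A point where [P] fails lies in an open set, which by irreducibility would meet the nonempty
    open set where [P] holds. *)
Lemma closed_generically (T : topologicalType) (P : T -> Prop) :
  irreducible [set: T] -> closed [set x | P x] -> generically P ->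
  forall x, P x.
Proof.
move=> [_ irrT] cP [U [oU [u Uu] PU]] x; apply: contrapT => nPx.
have oC : open (~` [set x | P x]) by rewrite openC.
have [||y [_ [Uy nPy]]] := irrT U _ oU oC; [by exists u|by exists x|].
exact/nPy/PU.
Qed.

(** The differential of [f], acting on derivations through the comorphism [h |-> h \o f]. *)
Definition push X Y (f : X -> Y) (v : (X -> K) -> K) : (Y -> K) -> K :=
  fun h => v (h \o f).

Definition pullback_form X Y (f : X -> Y) n (w : Defs.form Y n) : Defs.form X n :=
  fun p v => w (f p) (fun i => push f (v i)).

Lemma tangent_push X Y (f : X -> Y) (p : X) v :
  morphism f -> tangent p v -> tangent (f p) (push f v).
Proof.
by move=> mf tv h k rh rk; apply: (tv (h \o f) (k \o f)); apply: morphism_regular.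
Qed.

Lemma pushK X Y (f : X -> Y) (g : Y -> X) v :
  cancel g f -> push f (push g v) = v.
Proof.
move=> gK; apply/funext => h; rewrite /push; congr v.
by apply/funext => y /=; rewrite gK.
Qed.

(** * Tangent spaces, forms and divisors under an isomorphism *)

Section Isomorphism.
Context {X Y} {f : X -> Y} {g : Y -> X}.
Hypotheses (mf : morphism f) (mg : morphism g).
Hypotheses (fK : cancel f g) (gK : cancel g f).

Lemma generically_preimage (P : Y -> Prop) :
  generically P -> generically (P \o f).
Proof.
move=> [U [oU [u Uu] PU]]; exists (f @^-1` U); split.
- exact: morphism_open_preimage.
(* The inverse [g] supplies a point of the preimage. *)
- by exists (g u); rewrite /preimage /= gK.
- by move=> x /PU.
Qed.

Lemma tangent_lift (p : X) v : tangent (f p) v -> tangent p (push g v).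
Proof. by move=> /(tangent_push mg); rewrite fK. Qed.

(** The differentials of [f] and [g] are mutually inverse: independence is tested on functions
    [h \o g], and a derivation at [f p] is expanded after moving it to [p] by [push g]. *)
Lemma tangent_basis_push (p : X) n (e : 'I_n -> (X -> K) -> K) :
  tangent_basis p e -> tangent_basis (f p) (fun i => push f (e i)).
Proof.
move=> [te fe ge]; split.
- by move=> i; apply: tangent_push.
- move=> c c0; apply: fe => h rh.
  have rhg : regular_at (h \o g) (f p).
    by apply: morphism_regular => //; rewrite fK.
  rewrite -[RHS](c0 _ rhg); apply: eq_bigr => i _; congr (_ * e i _).
  by apply/funext => x /=; rewrite fK.
- move=> v /tangent_lift /ge[c cE]; exists c => h rh.
  rewrite -[in LHS](pushK v gK).
  exact/(cE (h \o f))/morphism_regular.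
Qed.

(** Pulling back [a db_1 /\ ... /\ db_n] replaces [a] and the [b_j] by their composites with [f];
    the determinants agree because [push f v] takes at [b] the value of [v] at [b \o f]. *)
Lemma regular_form_at_pullback n (w : Defs.form Y n) (p : X) :
  regular_form_at w (f p) -> regular_form_at (pullback_form f w) p.
Proof.
move=> [U [oU Ufp] [m [a [b ab]]]].
exists (f @^-1` U); first by split=> //; apply: morphism_open_preimage.
exists m, (fun i => a i \o f), (fun i j => b i j \o f) => q /ab[ra rb wE].
split=> [i|i j|v tv]; [exact: morphism_regular|exact: morphism_regular|].
by rewrite /pullback_form wE// => i; apply: tangent_push.
Qed.

Lemma nonzero_form_at_pullback n (w : Defs.form Y n) (p : X) :
  nonzero_form_at w (f p) -> nonzero_form_at (pullback_form f w) p.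
Proof.
move=> [v tv wv]; exists (fun i => push g (v i)).
  by move=> i; apply: tangent_lift.
rewrite /pullback_form; congr (w _ _ <> 0): wv.
by apply/funext => i; rewrite pushK.
Qed.

Lemma nonzero_rational_form_pullback n (w : Defs.form Y n) :
  nonzero_rational_form w -> nonzero_rational_form (pullback_form f w).
Proof.
move=> /generically_preimage; apply: generically_imply => p [rw nw].
by split; [exact: regular_form_at_pullback|exact: nonzero_form_at_pullback].
Qed.

Lemma form_equation_at_pullback n (w : Defs.form Y n) (h : Y -> K) (p : X) :
  form_equation_at w h (f p) ->
  form_equation_at (pullback_form f w) (h \o f) p.
Proof.
move=> [eta [reta neta /generically_preimage eqw]].
exists (pullback_form f eta); split.
- exact: regular_form_at_pullback.
- exact: nonzero_form_at_pullback.
- apply: generically_imply eqw => q wE v tv.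
  by apply: wE => i; apply: tangent_push.
Qed.

Lemma cartier_pullback (D : Y -> Y -> K) : cartier D -> cartier (pullback f D).
Proof.
move=> cD p; have [iD [U [oU Ufp] sD]] := cD (f p); split.
  apply: generically_imply (generically_preimage iD) => x [rx nx].
  by split=> //; apply: morphism_regular.
exists (f @^-1` U); first by split=> //; apply: morphism_open_preimage.
move=> q /sD[u [ru nu /generically_preimage gu]].
by exists (u \o f); split=> //; apply: morphism_regular.
Qed.

End Isomorphism.

(** * Canonical divisors under an automorphism *)

Section Automorphism.
Context {W} {f g : W -> W}.
Hypotheses (mf : morphism f) (mg : morphism g).
Hypotheses (fK : cancel f g) (gK : cancel g f).

Lemma smooth_at_automorphism (p : W) : smooth_at p -> smooth_at (f p).
Proof.
move=> [n dimW [e be]]; exists n => //.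
by exists (fun i => push f (e i)); apply: (tangent_basis_push mf mg).
Qed.

(** If [D] is the divisor of the rational form [w] on the smooth locus, then [pullback f D] is that
    of the pulled back form, since [f] preserves the smooth locus. *)
Lemma canonical_divisor_pullback (D : W -> W -> K) :
  canonical_divisor D -> canonical_divisor (pullback f D).
Proof.
move=> [cD [n dimW [w nw eqw]]]; split; first exact: (cartier_pullback mf gK).
exists n => //; exists (pullback_form f w).
  exact: (nonzero_rational_form_pullback mf mg).
move=> p /smooth_at_automorphism /eqw.
exact: (form_equation_at_pullback mf mg).
Qed.

Lemma relative_form_comp N (O : set W) d F :
  relative_form (N := N) O d F -> relative_form (f @^-1` O) d (F \o f).
Proof.
move=> rF w /rF[hF cF]; split=> // m.
exact: (morphism_regular mf (cF m)).
Qed.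

End Automorphism.

(** * Resolutions followed by an automorphism of the base *)

Section Composition.
Context {X W} {p : X -> W} {f g : W -> W}.
Hypotheses (mf : morphism f) (mg : morphism g).
Hypotheses (fK : cancel f g) (gK : cancel g f).

(** The homogeneous coordinates [a] are kept: the closed immersion into [P^N x W] is only followed
    by the automorphism [id x f]. *)
Lemma projective_automorphism : projective p -> projective (f \o p).
Proof.
move=> [N [a [a0 ainj aclosed [astr1 astr2]]]]; exists N, a.
(* Both immersions induce the same basic open sets and fractions on [X]: relative forms over [O] are
   carried across by composition with [g] in one direction and [f] in the other. *)
have fracE (D : set X) (h : X -> K) :
  (exists (O : set W) d F G,
     [/\ open O, relative_form (N := N) O d F, relative_form O d G,
         D = [set x | O (p x) /\ mpoly.meval (a x) (G (p x)) <> 0] &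
         h = (fun x => mpoly.meval (a x) (F (p x))
                         / mpoly.meval (a x) (G (p x)))]) <->
  (exists (O : set W) d F G,
     [/\ open O, relative_form (N := N) O d F, relative_form O d G,
         D = [set x | O (f (p x)) /\ mpoly.meval (a x) (G (f (p x))) <> 0] &
         h = (fun x => mpoly.meval (a x) (F (f (p x)))
                         / mpoly.meval (a x) (G (f (p x))))]).
  split=> -[O [d [F [G [oO rF rG -> ->]]]]].
  - exists (g @^-1` O), d, (F \o g), (G \o g); split.
    + exact: morphism_open_preimage.
    + exact: relative_form_comp.
    + exact: relative_form_comp.
    + by apply/funext => x /=; rewrite /preimage /= fK.
    + by apply/funext => x /=; rewrite fK.
  - exists (f @^-1` O), d, (F \o f), (G \o f); split=> //.
    + exact: morphism_open_preimage.
    + exact: relative_form_comp.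
    + exact: relative_form_comp.
split=> //.
- by move=> x y c /(can_inj fK); apply: ainj.
(* The point [(b, w)] avoids the new image exactly when [(b, g w)] avoids the old one, so an
   equation separating the latter is transported by [g]. *)
- move=> w b b0 nb; have [|O [d [F [[oO Ow] rF Fb F0]]]] := aclosed (g w) b b0.
    move=> [x [c [pix bE]]]; apply: nb; exists x, c; split=> //=.
    by rewrite pix gK.
  exists (g @^-1` O), d, (F \o g); split=> //.
  + by split=> //; apply: morphism_open_preimage.
  + exact: relative_form_comp.
  + by move=> x; rewrite /preimage /= fK; apply: F0.
- split.
    move=> V VT; apply: (iff_trans (astr1 V VT)); split=> VD x /VD;
      by move=> [D [h [/fracE DE Dx DV]]]; exists D, h.
  move=> x xT h; apply: (iff_trans (astr2 x xT h)); split;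
    by move=> [D [k [/fracE DE Dx kE]]]; exists D, k.
Qed.

Lemma rational_inverse_automorphism (s : W -> X) :
  rational_inverse p s -> rational_inverse (f \o p) (s \o g).
Proof.
move=> [U [V [oU [oV [v Vv]] sU sV]]]; exists U, (g @^-1` V); split=> //.
- split; first exact: morphism_open_preimage.
  by exists (f v); rewrite /preimage /= fK.
- by move=> x /sU; rewrite /preimage /= fK.
- move=> w /sV[Us pis ms]; split=> //=; first by rewrite pis gK.
  exact: morphic_at_comp.
Qed.

(** For crepancy, pulling [D] back along [f \o p] is pulling back along [p] the divisor
    [pullback f D], which is again canonical. *)
Lemma crepant_resolution_automorphism :
  crepant_resolution p -> crepant_resolution (f \o p).
Proof.
move=> [[smX mpi ppi [s bs]] cpi]; split; first split=> //.
- exact: morphism_comp.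
- exact: projective_automorphism.
- by exists (s \o g); apply: rational_inverse_automorphism.
- by move=> D /(canonical_divisor_pullback mf mg fK gK) /cpi.
Qed.

End Composition.

Lemma morphism_eq_generically (X Y : variety K) (f g : X -> Y) :
  morphism f -> morphism g -> generically (fun x => f x = g x) -> f = g.
Proof.
move=> mf mg; move/(closed_generically (variety_irreducible X)) => fg.
apply/funext/fg; exact: (variety_separated (variety_prevariety X) mf mg).
Qed.

(** A birational [pi] is dominant: a nonempty open set of [W] meets the domain [V] of the inverse
    [s], and [s] gives a point above the intersection. *)
Lemma generically_comp_birational X (W : variety K) (pi : X -> W)
    (P : W -> Prop) :
  morphism pi -> birational pi -> generically P -> generically (P \o pi).
Proof.
move=> mpi [s [U [V [_ [oV [v Vv]] _ sV]]]] [A [oA [a Aa] PA]].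
exists (pi @^-1` A); split; [exact: morphism_open_preimage| |by move=> x /PA].
have [_ irrW] := variety_irreducible W.
have [||w [_ [/sV[_ pis _] Aw]]] := irrW V A oV oA; [by exists v|by exists a|].
by exists (s w); rewrite /preimage /= pis.
Qed.

End Transport.

Theorem proposition1p1 (R : realType) (W : variety R[i])
  (smoothW : smooth_in_codim1 W) (cartierW : canonical_cartier W)
  (X : variety R[i]) (pi : X -> W) (crepant_pi : crepant_resolution pi)
  (unique_pi : forall (X' : variety R[i]) (pi' : X' -> W),
     crepant_resolution pi' -> isomorphic_resolutions pi pi')
  (psi : W -> W) (auto_psi : automorphism psi) :
  exists psit : X -> X, automorphism psit /\ pi \o psit = psi \o pi.
Proof.
have [mpsi [g [mg psiK gK]]] := auto_psi.
have [[_ mpi _ bpi] _] := crepant_pi.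
have := unique_pi _ _
  (crepant_resolution_automorphism mpsi mg psiK gK crepant_pi).
move=> [s [[U [V [_ [oV V0] _ sV]]] [phi [iso_phi phiE]]]].
exists phi; split=> //; have [mphi _] := iso_phi.
apply: morphism_eq_generically; [exact: morphism_comp|exact: morphism_comp|].
(* Generically [phi x = s (psi (pi x))]; to cancel [pi] against [s], the point [psi (pi x)] must lie
   in [V], which also holds generically in [x]. *)
have genV : generically V by exists V.
have genV' := generically_comp_birational mpi bpi
  (generically_preimage mpsi gK genV).
have := generically_and (variety_irreducible X) phiE genV'.
by apply: generically_imply => x [/= -> /sV[_ ->]].
Qed.
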